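(* Let $L$ be a selfadjoint operator on $L^{2}(\mathbb{R}^{n};\mathbb{C}^{k})$ and let $\phi:\mathbb{R}^{n}\to\mathbb{R}$ be a function. Let $u=u(t,x)$, $u:\mathbb{R}\times\mathbb{R}^{n}\to\mathbb{C}^{k}$, be a solution of $$u_{tt}(t,x)+Lu(t,x)=0,$$ and define $$\Theta(t)=(\phi u_t,u_t)+\Re\big((2\phi L-L\phi)u,u\big).$$ Then $u$ satisfies the formal identities $$\dot\Theta(t)=\Re\big([L,\phi]u,u_t\big),\qquad \ddot\Theta(t)=-\tfrac12\big([L,[L,\phi]]u,u\big).$$
   Context: Round brackets denote the inner product of $L^2(\mathbb{R}^n;\mathbb{C}^k)$: $(F,G)=\int_{\mathbb{R}^n}F\cdot\overline{G}\,dx$. The symbol $\phi$ also denotes the operator of multiplication by the real function $\phi$, and $[S,T]=ST-TS$ is the commutator of operators. Dots denote time derivatives. ''Formal identities'' means that they are asserted for solutions $u$ and multipliers $\phi$ regular enough that all the expressions appearing (the products of $L$ and $\phi$ applied to $u$ and $u_t$, and their inner products) are well defined, the inner products may be differentiated in time by the product rule, and the symmetry of $L$ and of multiplication by $\phi$ may be used on these expressions. *)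

(* Defs.v *)
From HB Require Import structures.
From mathcomp Require Import all_boot all_order all_algebra.
From mathcomp Require Import generic_quotient ring_quotient.
From mathcomp Require Import all_classical all_reals all_analysis.
From mathcomp.real_closed Require Import complex.

Set Implicit Arguments.
Unset Strict Implicit.
Unset Printing Implicit Defensive.

Import Order.TTheory GRing.Theory Num.Theory.
Import numFieldNormedType.Exports.

Local Open Scope classical_set_scope.
Local Open Scope ring_scope.
Local Open Scope complex_scope.

(* Re and Im also name the projections of numClosedFieldType *)
Notation Re := (@complex.Re _).
Notation Im := (@complex.Im _).

Section LebesgueRn.
Variable R : realType.

Definition Rn (n : nat) := n.-tuple (measurableTypeR R).

(* The library has no Lebesgue measure on R^n: it is built as the n-fold product
   of the one on R, a tuple of size n.+1 being identified with a pair. *)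
Definition consRn n (p : measurableTypeR R * Rn n) : Rn n.+1 :=
  [tuple of p.1 :: p.2].

Definition unconsRn n (x : Rn n.+1) : measurableTypeR R * Rn n :=
  (thead x, [tuple of behead x]).

Lemma consRnK n : cancel (@consRn n) (@unconsRn n).
Proof. by move=> [x t]; apply/pair_equal_spec; split=> //; exact/val_inj. Qed.

Lemma unconsRnK n : cancel (@unconsRn n) (@consRn n).
Proof. by move=> t; rewrite /consRn /= -tuple_eta. Qed.

Lemma measurable_consRn n : measurable_fun setT (@consRn n).
Proof. by apply: measurable_cons; [exact: measurable_fst|exact: measurable_snd]. Qed.

Lemma measurable_unconsRn n : measurable_fun setT (@unconsRn n).
Proof.
by apply/measurable_fun_pairP; split; [exact: measurable_tnth|exact: measurable_behead].
Qed.

Section step.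
Variables (n : nat) (m : {sigma_finite_measure set (Rn n) -> \bar R}).

Definition leb_step : set (Rn n.+1) -> \bar R :=
  pushforward (product_measure1 (@lebesgue_measure R) m) (@consRn n).

Let leb_step0 : leb_step set0 = 0%E.
Proof. by rewrite /leb_step /pushforward preimage_set0 measure0. Qed.

Let leb_step_ge0 A : (0 <= leb_step A)%E.
Proof. by rewrite /leb_step /pushforward; exact: measure_ge0. Qed.

Let leb_step_sigma_additive : semi_sigma_additive leb_step.
Proof.
exact: (@measure_semi_sigma_additive _ _ _
  (measure_function_pushforward__canonical__measure_function_Measure (product_measure1 (@lebesgue_measure R) m) (@measurable_consRn n))).
Qed.

HB.instance Definition _ :=
  isMeasure.Build _ _ _ leb_step leb_step0 leb_step_ge0 leb_step_sigma_additive.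

Let leb_step_sigma_finite : sigma_finite setT leb_step.
Proof.
have /sigma_finiteP[F [FT ndF Foo]] := sigma_finiteT (@lebesgue_measure R).
have /sigma_finiteP[G [GT ndG Goo]] := sigma_finiteT m.
exists (fun i => @unconsRn n @^-1` (F i `*` G i)).
  rewrite -preimage_bigcup -[LHS](preimage_setT (@unconsRn n)); congr preimage.
  rewrite -setXTT FT GT predeqE => -[x y]; split.
    move=> [/= [i _ Fix] [j _ Gjy]]; exists (maxn i j) => //; split.
    - by move: x Fix; exact/subsetPset/ndF/leq_maxl.
    - by move: y Gjy; exact/subsetPset/ndG/leq_maxr.
  by move=> [i _ []/= ? ?]; split; exists i.
move=> i; have [mF Fi] := Foo i; have [mG Gi] := Goo i; split.
  rewrite -[X in measurable X]setTI.
  by apply: measurable_unconsRn => //; exact: measurableX.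
rewrite /leb_step /pushforward -comp_preimage.
rewrite (_ : _ \o _ = id); last by apply/funext => x; exact: consRnK.
by rewrite preimage_id product_measure1E// lte_mul_pinfty// ge0_fin_numE.
Qed.

HB.instance Definition _ :=
  Measure_isSigmaFinite.Build _ _ _ leb_step leb_step_sigma_finite.

End step.

Fixpoint lebesgue_Rn n : {sigma_finite_measure set (Rn n) -> \bar R} :=
  match n with
  | 0 => \d_([tuple] : Rn 0)
  | n'.+1 => leb_step (lebesgue_Rn n')
  end.

End LebesgueRn.

Section L2space.
Context d (T : measurableType d) (R : realType).
Variables (mu : {measure set T -> \bar R}) (k : nat).

Definition l2fun : {pred T -> 'rV[R[i]]_k} :=
  mem [set F : T -> 'rV[R[i]]_k | forall j,
    (fun x => Re (F x ord0 j)) \in Lfun mu 2%:E /\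
    (fun x => Im (F x ord0 j)) \in Lfun mu 2%:E].

Lemma l2fun_submod_closed : submod_closed l2fun.
Proof.
have le12 : (1 <= 2%:E :> \bar R)%E by rewrite lee_fin ler1n.
have [L0 LP] := Lfun_submod_closed mu le12.
have LD (f g : T -> R) : f \in Lfun mu 2%:E -> g \in Lfun mu 2%:E ->
    (fun x => f x + g x) \in Lfun mu 2%:E.
  by move=> fL gL; have := LP 1 f g fL gL; rewrite scale1r.
have LZ a (f : T -> R) : f \in Lfun mu 2%:E ->
    (fun x => a * f x) \in Lfun mu 2%:E.
  by move=> fL; have := LP a f 0 fL L0; rewrite addr0.
split.
  rewrite inE /= => j.
  have -> : (fun x => Re ((0 : T -> 'rV[R[i]]_k) x ord0 j)) = 0.
    by apply/funext => x; rewrite -[RHS]/(Re 0); congr Re; exact: mxE.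
  have -> : (fun x => Im ((0 : T -> 'rV[R[i]]_k) x ord0 j)) = 0.
    by apply/funext => x; rewrite -[RHS]/(Im 0); congr Im; exact: mxE.
  by split.
move=> [a b] F G; rewrite !inE /= => LF LG j.
have [FR FI] := LF j; have [GR GI] := LG j.
have E x : ((a +i* b) *: F + G) x ord0 j =
    (a +i* b) * F x ord0 j + G x ord0 j by rewrite fctE !mxE.
split.
  have -> : (fun x => Re (((a +i* b) *: F + G) x ord0 j)) =
      (fun x => a * Re (F x ord0 j) + - b * Im (F x ord0 j) + Re (G x ord0 j)).
    apply/funext => x; rewrite E.
    by case: (F x _ _) (G x _ _) => [? ?] [? ?] /=; rewrite mulNr.
  exact: (LD _ _ (LD _ _ (LZ a _ FR) (LZ (- b) _ FI)) GR).
have -> : (fun x => Im (((a +i* b) *: F + G) x ord0 j)) =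
    (fun x => a * Im (F x ord0 j) + b * Re (F x ord0 j) + Im (G x ord0 j)).
  by apply/funext => x; rewrite E; case: (F x _ _) (G x _ _) => [? ?] [? ?].
exact: (LD _ _ (LD _ _ (LZ a _ FI) (LZ b _ FR)) GI).
Qed.
HB.instance Definition _ :=
  GRing.isSubmodClosed.Build _ _ l2fun l2fun_submod_closed.

(* square integrable functions, before identification almost everywhere *)
Record l2type := L2fun { l2val :> T -> 'rV[R[i]]_k; _ : l2val \in l2fun }.
HB.instance Definition _ := [isSub for l2val].
HB.instance Definition _ := [Choice of l2type by <:].
HB.instance Definition _ := [SubChoice_isSubLmodule of l2type by <:].

Definition l2null : {pred l2type} :=
  mem [set F : l2type | {ae mu, forall x, F x = 0}].

Lemma l2null_submod_closed : submod_closed l2null.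
Proof.
split; first by rewrite inE /=; exact: nearW.
move=> a F G; rewrite !inE /= => F0 G0.
by apply: filterS2 F0 G0 => x Fx Gx; rewrite [LHS](_ : _ = a *: F x + G x)// Fx Gx scaler0 addr0.
Qed.
HB.instance Definition _ :=
  GRing.isSubmodClosed.Build _ l2type l2null l2null_submod_closed.

Definition L2 := Quotient.quot l2null.
HB.instance Definition _ := GRing.Zmodule.on L2.
HB.instance Definition _ := EqQuotient.on L2.

Local Open Scope quotient_scope.

Lemma L2piD (F G : l2type) : \pi_L2 (F + G) = \pi_L2 F + \pi_L2 G :> L2.
Proof. exact: Quotient.pi_add. Qed.

Definition L2scale (a : R[i]) (F : L2) : L2 := \pi_L2 (a *: repr F).

Lemma L2scale_pi a (F : l2type) : L2scale a (\pi_L2 F) = \pi_L2 (a *: F).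
Proof.
apply/eqP; rewrite -Quotient.idealrBE -scalerBr rpredZ//.
by rewrite Quotient.idealrBE reprK; apply/eqP.
Qed.

Lemma L2scaleA a b F : L2scale a (L2scale b F) = L2scale (a * b) F.
Proof. by elim/quotW: F => F; rewrite (L2scale_pi b) !L2scale_pi scalerA. Qed.

Lemma L2scale1 : left_id 1 L2scale.
Proof. by elim/quotW => F; rewrite L2scale_pi scale1r. Qed.

Lemma L2scaleDr : right_distributive L2scale +%R.
Proof.
move=> a; elim/quotW => F; elim/quotW => G.
by rewrite -L2piD !L2scale_pi -L2piD scalerDr.
Qed.

Lemma L2scaleDl F : {morph L2scale^~ F : a b / a + b}.
Proof.
by elim/quotW: F => F a b; rewrite !L2scale_pi -L2piD scalerDl.
Qed.

HB.instance Definition _ := GRing.Zmodule_isLmodule.Build R[i] L2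
  L2scaleA L2scale1 L2scaleDr L2scaleDl.

Definition L2fun_of (F : L2) : T -> 'rV[R[i]]_k := l2val (repr F).

Definition ip (F G : L2) : R[i] :=
  let fg x := \sum_(j < k) L2fun_of F x ord0 j * (L2fun_of G x ord0 j)^* in
  (\int[mu]_x Re (fg x)) +i* (\int[mu]_x Im (fg x)).

Definition L2norm (F : L2) : R := Num.sqrt (Re (ip F F)).

End L2space.

Notation L2Rn R n k := (L2 (@lebesgue_Rn R n) k).

(* Unbounded operators: only the values of [app] on [dom] are meaningful. *)
Record operator (R : realType) (V : lmodType R[i]) :=
  Operator { dom : set V ; app :> V -> V }.

Section operator_algebra.
Context (R : realType) (V : lmodType R[i]).
Implicit Types S T : operator V.

Definition op_scale (a : R[i]) S : operator V :=
  Operator (dom S) (fun f => a *: S f).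

Definition op_sub S T : operator V :=
  Operator (dom S `&` dom T) (fun f => S f - T f).

Definition op_comp S T : operator V :=
  Operator [set f | dom T f /\ dom S (T f)] (fun f => S (T f)).

Definition commutator S T : operator V :=
  op_sub (op_comp S T) (op_comp T S).

Definition op_linear S := dom S 0 /\
  forall a f g, dom S f -> dom S g ->
    dom S (a *: f + g) /\ S (a *: f + g) = a *: S f + S g.

End operator_algebra.

Declare Scope operator_scope.
Delimit Scope operator_scope with OP.
Notation "a *: S" := (op_scale a S) : operator_scope.
Notation "S - T" := (op_sub S T) : operator_scope.
Notation "S * T" := (op_comp S T) : operator_scope.
Notation "[ S , T ]" := (commutator S T) : operator_scope.

Section operators_on_L2.
Context (R : realType) (n k : nat).
Local Notation H := (L2Rn R n k).
Implicit Types (L S : operator H) (u v w : R -> H).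

Definition densely_defined L := forall f (e : R), 0 < e ->
  exists2 g, dom L g & L2norm (f - g) < e.

(* (g, h) belongs to the graph of the adjoint of L *)
Definition adjoint_graph L (g h : H) :=
  forall f, dom L f -> ip (L f) g = ip f h.

Definition selfadjoint L :=
  [/\ op_linear L, densely_defined L &
      forall g h, adjoint_graph L g h <-> dom L g /\ L g = h].

Definition is_product (phi : n.-tuple R -> R) (F G : H) :=
  {ae lebesgue_Rn R n,
    forall x, L2fun_of G x = (phi x)%:C *: L2fun_of F x}.

(* multiplication by phi, on the maximal domain {F in L2 | phi F in L2} *)
Definition mult (phi : n.-tuple R -> R) : operator H :=
  Operator [set F | exists G, is_product phi F G]
           (fun F => xget 0 [set G | is_product phi F G]).

(* v is the time derivative of the curve u, in the norm of L2 *)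
Definition is_time_derivative u v := forall t,
  (fun h : R => L2norm ((h^-1)%:C *: (u (t + h) - u t) - v t))
    @ 0^' --> (0 : R).

Definition solution L u ut utt :=
  [/\ is_time_derivative u ut, is_time_derivative ut utt &
      forall t, dom L (u t) /\ utt t + L (u t) = 0].

Definition cderivable (f : R -> R[i]) (t : R) :=
  derivable (fun s => Re (f s)) t 1 /\ derivable (fun s => Im (f s)) t 1.

Definition dot (f : R -> R[i]) (t : R) : R[i] :=
  derive1 (fun s => Re (f s)) t +i* derive1 (fun s => Im (f s)) t.

Definition product_rule S v vt w wt := forall t,
  cderivable (fun s => ip (S (v s)) (w s)) t /\
  dot (fun s => ip (S (v s)) (w s)) t =
    ip (S (vt t)) (w t) + ip (S (v t)) (wt t).

Section identities.
Variables (L : operator H) (phi : n.-tuple R -> R) (u ut utt : R -> H).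
Local Notation Phi := (mult phi : operator H).

(* The regularity under which formal identities are asserted: every expression
   is defined, and the inner products in Theta and in its first derivative obey
   the product rule. The symmetry of L and phi is not assumed here: on these
   domains it follows from selfadjointness of L and from phi being real. *)
Record regular : Prop := Regular {
  regular_u : forall t, dom (2 *: (Phi * L) - L * Phi)%OP (u t) ;
  regular_ut : forall t, dom (2 *: (Phi * L) - L * Phi)%OP (ut t) ;
  regular_comm : forall t, dom [L, [L, Phi]]%OP (u t) ;
  regular_dot_kinetic : product_rule Phi ut utt ut utt ;
  regular_dot_potential :
    product_rule (2 *: (Phi * L) - L * Phi)%OP u ut u ut ;
  regular_dot_comm : product_rule [L, Phi]%OP u ut ut utt }.

Definition Theta (t : R) : R[i] :=
  ip (Phi (ut t)) (ut t) +
  (Re (ip ((2 *: (Phi * L) - L * Phi)%OP (u t)) (u t)))%:C.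

End identities.
End operators_on_L2.
Arguments mult {R n k} phi.

(* Main.v *)
(* The product rule and u_tt = - L u express the derivative of Theta through
   inner products, which the symmetry of L and phi reduces to combinations of
   Re(phi L u, u_t) and Re(L phi u, u_t); the coefficients in Theta are such that
   Re([L, phi] u, u_t) is what remains. As the commutator C = [L, phi] is
   antisymmetric, Re(C u_t, u_t) = 0, so the second derivative is - Re(C u, L u),
   while ([L, C] u, u) = (C u, L u) + (L u, C u) = 2 Re(C u, L u). *)
Require Import Defs.
From mathcomp Require Import all_boot all_order all_algebra.
From mathcomp Require Import generic_quotient ring_quotient.
From mathcomp Require Import all_classical all_reals all_analysis.
From mathcomp.real_closed Require Import complex.
From mathcomp Require Import ring.

Set Implicit Arguments.
Unset Strict Implicit.
Unset Printing Implicit Defensive.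

Import Order.TTheory GRing.Theory Num.Theory.
Import numFieldNormedType.Exports.

Local Open Scope ring_scope.
Local Open Scope complex_scope.

(* Num.Theory rebinds these names to the projections of numClosedFieldType. *)
Local Notation Re := complex.Re.
Local Notation Im := complex.Im.

(** * Real and imaginary parts of complex numbers *)

Section complex_parts.
Variable R : rcfType.
Implicit Types x y : R[i].

Lemma ReD x y : Re (x + y) = Re x + Re y. Proof. by case: x; case: y. Qed.
Lemma ImD x y : Im (x + y) = Im x + Im y. Proof. by case: x; case: y. Qed.
Lemma ReN x : Re (- x) = - Re x. Proof. by case: x. Qed.
Lemma ImN x : Im (- x) = - Im x. Proof. by case: x. Qed.
Lemma Re_conj x : Re (Num.conj x) = Re x. Proof. by case: x. Qed.
Lemma Im_conj x : Im (Num.conj x) = - Im x. Proof. by case: x. Qed.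
Lemma ReM x y : Re (x * y) = Re x * Re y - Im x * Im y.
Proof. by case: x; case: y. Qed.
Lemma ImM x y : Im (x * y) = Re x * Im y + Im x * Re y.
Proof. by case: x; case: y. Qed.

Lemma Re_sum (I : finType) (f : I -> R[i]) :
  Re (\sum_i f i) = \sum_i Re (f i).
Proof. exact: (big_morph _ ReD). Qed.

Lemma Im_sum (I : finType) (f : I -> R[i]) :
  Im (\sum_i f i) = \sum_i Im (f i).
Proof. exact: (big_morph _ ImD). Qed.

End complex_parts.

(** * Additivity and Hermitian symmetry of the inner product on $L^2$ *)

Section L2_inner_product.
Context d (T : measurableType d) (R : realType).
Variables (mu : {measure set T -> \bar R}) (k : nat).
Implicit Types (f g : T -> 'rV[R[i]]_k) (F G H : L2 mu k).

Definition ptip f g (x : T) : R[i] :=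
  \sum_(j < k) f x ord0 j * (g x ord0 j)^*.

Definition cint (h : T -> R[i]) : R[i] :=
  (\int[mu]_x Re (h x)) +i* (\int[mu]_x Im (h x)).

Definition cintegrable (h : T -> R[i]) :=
  mu.-integrable setT (EFin \o (fun x => Re (h x))) /\
  mu.-integrable setT (EFin \o (fun x => Im (h x))).

Lemma ipE F G : ip F G = cint (ptip (L2fun_of F) (L2fun_of G)).
Proof. by []. Qed.

Lemma Lfun2_integrableM (a b : T -> R) :
  a \in Lfun mu 2%:E -> b \in Lfun mu 2%:E ->
  mu.-integrable setT (EFin \o (fun x => a x * b x)).
Proof. by move=> aL bL; apply/Lfun1_integrable; exact: Lfun2_mul_Lfun1. Qed.

(** Both parts of the integrand are finite sums of products of two square integrable real functions,
    each integrable by Hölder. *)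
Lemma ptip_cintegrable f g : f \in l2fun mu (k:=k) -> g \in l2fun mu (k:=k) ->
  cintegrable (ptip f g).
Proof.
rewrite !inE /= => Lf Lg; split.
- have -> : EFin \o (fun x => Re (ptip f g x)) = (fun x => \sum_(j < k)
      ((Re (f x ord0 j) * Re (g x ord0 j))%:E +
       (Im (f x ord0 j) * Im (g x ord0 j))%:E))%E.
    apply/funext => x /=; rewrite Re_sum -sumEFin; apply: eq_bigr => j _.
    by rewrite ReM Re_conj Im_conj mulrN opprK.
  apply: integrable_sum => // j _; have [fR fI] := Lf j; have [gR gI] := Lg j.
  by apply: integrableD => //; exact: Lfun2_integrableM.
- have -> : EFin \o (fun x => Im (ptip f g x)) = (fun x => \sum_(j < k)
      ((Im (f x ord0 j) * Re (g x ord0 j))%:E -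
       (Re (f x ord0 j) * Im (g x ord0 j))%:E))%E.
    apply/funext => x /=; rewrite Im_sum -sumEFin; apply: eq_bigr => j _.
    by rewrite ImM Re_conj Im_conj mulrN addrC EFinB.
  apply: integrable_sum => // j _; have [fR fI] := Lf j; have [gR gI] := Lg j.
  by apply: integrableB => //; exact: Lfun2_integrableM.
Qed.

Lemma ae_eq_Rintegral (a b : T -> R) :
  mu.-integrable setT (EFin \o a) -> mu.-integrable setT (EFin \o b) ->
  {ae mu, forall x, a x = b x} -> \int[mu]_x a x = \int[mu]_x b x.
Proof.
move=> /(measurable_int mu) ma /(measurable_int mu) mb ab.
rewrite /Rintegral; congr fine; apply: ae_eq_integral => //.
by apply: filterS ab => x abx _; congr EFin.
Qed.

Lemma ae_eq_cint (h1 h2 : T -> R[i]) : cintegrable h1 -> cintegrable h2 ->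
  {ae mu, forall x, h1 x = h2 x} -> cint h1 = cint h2.
Proof.
move=> [R1 I1] [R2 I2] h12; congr (_ +i* _).
  by apply: ae_eq_Rintegral => //; apply: filterS h12 => x ->.
by apply: ae_eq_Rintegral => //; apply: filterS h12 => x ->.
Qed.

Lemma cintB (h1 h2 : T -> R[i]) : cintegrable h1 -> cintegrable h2 ->
  cint (fun x => h1 x - h2 x) = cint h1 - cint h2.
Proof.
move=> [R1 I1] [R2 I2]; rewrite /cint.
under eq_Rintegral do rewrite ReD ReN.
under [X in _ +i* X]eq_Rintegral do rewrite ImD ImN.
by rewrite !RintegralB.
Qed.

Lemma cintegrableB (h1 h2 : T -> R[i]) : cintegrable h1 -> cintegrable h2 ->
  cintegrable (fun x => h1 x - h2 x).
Proof.
move=> [R1 I1] [R2 I2]; split.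
  apply: eq_integrable (integrableB _ R1 R2) => // x _ /=.
  by rewrite ReD ReN.
apply: eq_integrable (integrableB _ I1 I2) => // x _ /=.
by rewrite ImD ImN.
Qed.

Lemma L2fun_of_l2 F : L2fun_of F \in l2fun mu (k:=k).
Proof. by rewrite /L2fun_of; case: (repr F). Qed.

(** [L2fun_of] chooses a representative of each class, so the two sides differ by an element of
    [l2null] and agree only almost everywhere. *)
Lemma L2fun_ofB F G :
  {ae mu, forall x, L2fun_of (F - G) x = L2fun_of F x - L2fun_of G x}.
Proof.
have : repr (F - G) - (repr F - repr G) \in l2null (mu:=mu) (k:=k).
  rewrite Quotient.idealrBE reprK; apply/eqP.
  by rewrite Quotient.pi_add Quotient.pi_opp !reprK.
rewrite inE /=; apply: filterS => x.
rewrite [X in X = _ -> _](_ : _ =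
  L2fun_of (F - G) x - (L2fun_of F x - L2fun_of G x))//.
by move/eqP; rewrite subr_eq0 => /eqP.
Qed.

Lemma L2fun_ofN F : {ae mu, forall x, L2fun_of (- F) x = - L2fun_of F x}.
Proof.
(* The representative chosen for the zero class vanishes almost everywhere, by comparison with
   $F-F$. *)
have := L2fun_ofB 0 F; have := L2fun_ofB F F; rewrite subrr sub0r.
by apply: filterS2 => x E0 ->; rewrite E0 subrr sub0r.
Qed.

(** Equality of classes is a condition on differences, so subtraction comes first; zero, opposites
    and sums follow from it. *)
Lemma ipBl F G H : ip (F - G) H = ip F H - ip G H.
Proof.
have L2 := L2fun_of_l2; rewrite !ipE -cintB; do ?exact: ptip_cintegrable.
apply: ae_eq_cint; first exact: ptip_cintegrable.
  by apply: cintegrableB; exact: ptip_cintegrable.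
apply: filterS (L2fun_ofB F G) => x FG.
by rewrite /ptip -sumrB; apply: eq_bigr => j _; rewrite FG !mxE mulrBl.
Qed.

Lemma ip_conj F G : ip F G = (ip G F)^*.
Proof.
rewrite !ipE /cint; congr (_ +i* _).
  apply: eq_Rintegral => x _; rewrite !Re_sum; apply: eq_bigr => j _.
  by rewrite !ReM !Re_conj !Im_conj; ring.
have [_ I] := ptip_cintegrable (L2fun_of_l2 G) (L2fun_of_l2 F).
(* The sign of the imaginary part enters the integral by integrability. *)
rewrite -mulN1r -RintegralZl//; apply: eq_Rintegral => x _.
rewrite mulN1r !Im_sum -sumrN; apply: eq_bigr => j _.
by rewrite !ImM !Re_conj !Im_conj; ring.
Qed.

Lemma ip0l H : ip 0 H = 0.
Proof. by have := ipBl 0 0 H; rewrite !subrr. Qed.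

Lemma ipNl F H : ip (- F) H = - ip F H.
Proof. by rewrite -sub0r ipBl ip0l sub0r. Qed.

Lemma ipDl F G H : ip (F + G) H = ip F H + ip G H.
Proof. by rewrite -{1}[G]opprK ipBl ipNl opprK. Qed.

Lemma ipNr F G : ip F (- G) = - ip F G.
Proof. by rewrite ip_conj ipNl rmorphN /= [in RHS]ip_conj. Qed.

Lemma ipBr F G H : ip F (G - H) = ip F G - ip F H.
Proof. by rewrite ip_conj ipBl rmorphB /= [ip F G]ip_conj [ip F H]ip_conj. Qed.

Lemma ip2l F G : ip (2 *: F) G = 2 * ip F G.
Proof. by rewrite scaler_nat mulr2n ipDl mulr_natl. Qed.

End L2_inner_product.

(** * Symmetry of $L$ and of multiplication by $\phi$ *)

Section symmetric_operators.
Variables (R : realType) (n k : nat).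
Implicit Types (L : operator (L2Rn R n k)) (phi : n.-tuple R -> R).
Implicit Types F G : L2Rn R n k.

Definition symmetric_op L := forall F G, dom L F -> dom L G ->
  ip (L F) G = ip F (L G).

Lemma selfadjoint_symmetric L : selfadjoint L -> symmetric_op L.
Proof.
move=> [_ _ adjL] F G LF LG.
(* The pair $(G,LG)$ lies in the graph of the adjoint. *)
by have [_ /(_ (conj LG erefl))] := adjL G (L G); apply.
Qed.

(** Membership in the domain says that a product exists, so [xget] returns one and not its default
    0. *)
Lemma multP phi F : dom (mult phi) F -> is_product phi F (mult phi F).
Proof. exact: (@xgetPex _ 0 (is_product phi F)). Qed.

(** The value $\phi(x)$ is real, hence equal to its conjugate, and moves across the pointwise
    product. *)
Lemma mult_symmetric phi : symmetric_op (mult phi).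
Proof.
move=> F G /multP pF /multP pG; rewrite !ipE; apply: ae_eq_cint.
- by apply: ptip_cintegrable; exact: L2fun_of_l2.
- by apply: ptip_cintegrable; exact: L2fun_of_l2.
apply: filterS2 pF pG => x Fx Gx; apply: eq_bigr => j _.
rewrite Fx Gx !mxE; case: (L2fun_of F x _ _) (L2fun_of G x _ _) => [a b] [a' b'].
by apply/eqP; rewrite eq_complex /=; apply/andP; split; apply/eqP; ring.
Qed.

(** Serves to multiply $u_{tt}=-Lu$ by $\phi$, given that $\phi Lu$ is defined. *)
Lemma dom_multN phi F : dom (mult phi) F -> dom (mult phi) (- F).
Proof.
move=> [G pG]; exists (- G); rewrite /is_product.
apply: filterS3 (L2fun_ofN F) (L2fun_ofN G) pG => x -> -> ->.
by rewrite scalerN.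
Qed.

End symmetric_operators.

(** * Inner product identities for the commutator of two symmetric operators *)

Section commutator_identities.
Variables (R : realType) (n k : nat).
Variables (L P : operator (L2Rn R n k)).
Hypotheses (symL : symmetric_op L) (symP : symmetric_op P).
Implicit Types v w : L2Rn R n k.

Lemma commutatorE (S T : operator (L2Rn R n k)) v :
  [S, T]%OP v = S (T v) - T (S v).
Proof. by []. Qed.

Let potentialE v : (2 *: (P * L) - L * P)%OP v = 2 *: P (L v) - L (P v).
Proof. by []. Qed.

(** For $v=u$, $w=u_t$ the left side is what the product rule gives for $\dot\Theta$. With
    $A=(PLv,w)$ and $B=(LPv,w)$, the kinetic terms sum to $-A-\overline{A}$ and the potential ones
    are $2\overline{B}-\overline{A}$ and $2A-B$; the real part of the total is $\Re B-\Re A$. *)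
Lemma ip_Theta_dot v w : dom P (- L v) ->
  dom (2 *: (P * L) - L * P)%OP v -> dom (2 *: (P * L) - L * P)%OP w ->
  ip (P (- L v)) w + ip (P w) (- L v) +
    (Re (ip ((2 *: (P * L) - L * P)%OP w) v +
         ip ((2 *: (P * L) - L * P)%OP v) w))%:C =
  (Re (ip ([L, P]%OP v) w))%:C.
Proof.
move=> PNLv [[Lv PLv] [Pv LPv]] [[Lw PLw] [Pw LPw]].
rewrite !potentialE commutatorE (symP PNLv Pw) !ipBl !ip2l ipNl ipNr (symP Pw PLv) -(symP PLv Pw).
rewrite (symP PLw Pv) (symL Lw LPv) (symL LPw Lv) (symP Pw PLv).
rewrite !(ip_conj w).
case: (ip (P (L v)) w) (ip (L (P v)) w) => [a b] [a' b'].
by apply/eqP; rewrite eq_complex /=; apply/andP; split; apply/eqP; ring.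
Qed.

(** By symmetry $(LPw,w)=(Pw,Lw)$ and $(PLw,w)=(Lw,Pw)$ are conjugate, so their difference is
    imaginary. *)
Lemma Re_ip_commutator w : dom [L, P]%OP w -> Re (ip ([L, P]%OP w) w) = 0.
Proof.
move=> [[Pw LPw] [Lw PLw]].
rewrite commutatorE ipBl (symL LPw Lw) (symP PLw Pw) (ip_conj (L w)).
by case: (ip (P w) (L w)) => [a b] /=; rewrite subrr.
Qed.

Lemma ip_double_commutator v : dom [L, [L, P]]%OP v ->
  ip ([L, [L, P]]%OP v) v = 2 * (Re (ip ([L, P]%OP v) (L v)))%:C.
Proof.
move=> [[[[Pv LPv] [Lv PLv]] LCv] [_ [[_ LPLv] [LLv PLLv]]]].
(* The outer $L$ of $LCv$ moves across at once. In $C(Lv)$ the factors move one at a time, each on a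
   vector known to be in its domain, which leaves $-(Lv,Cv)$. *)
rewrite [X in ip X v]commutatorE ipBl (symL LCv Lv) (commutatorE L P (L v)).
rewrite (ipBl (L (P (L v)))) (symL LPLv Lv) (symP PLLv Pv) (symL LLv LPv) (symP PLv PLv).
rewrite -ipBr -(opprB (L (P v))) -commutatorE ipNr opprK (ip_conj (L v)).
exact: addcJ.
Qed.

End commutator_identities.

(** * Time derivatives of complex-valued functions *)

Section complex_derivative.
Variable R : realType.
Implicit Types (f g : R -> R[i]) (t : R).

Lemma dotD f g t : cderivable f t -> cderivable g t ->
  cderivable (fun s => f s + g s) t /\
  dot (fun s => f s + g s) t = dot f t + dot g t.
Proof.
move=> [fR fI] [gR gI].
have E1 : (fun s => Re (f s + g s)) = (fun s => Re (f s)) + (fun s => Re (g s)).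
  by apply/funext => s; rewrite ReD.
have E2 : (fun s => Im (f s + g s)) = (fun s => Im (f s)) + (fun s => Im (g s)).
  by apply/funext => s; rewrite ImD.
rewrite /cderivable /dot E1 E2; split; first by split; exact: derivableD.
by rewrite !derive1E !deriveD.
Qed.

Lemma dotRe f t : cderivable f t ->
  cderivable (fun s => (Re (f s))%:C) t /\
  dot (fun s => (Re (f s))%:C) t = (Re (dot f t))%:C.
Proof.
move=> [fR _]; split; first by split => //; exact: derivable_cst.
by rewrite /dot /= derive1_cst.
Qed.

End complex_derivative.

Theorem theorem1p1 (R : realType) (n k : nat)
  (L : operator (L2Rn R n k)) (HL : selfadjoint L)
  (phi : n.-tuple R -> R)
  (u ut utt : R -> L2Rn R n k)
  (Hu : solution L u ut utt)
  (Hreg : regular L phi u ut utt) :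
  forall t : R,
    [/\ cderivable (Theta L phi u ut) t,
        dot (Theta L phi u ut) t
          = (complex.Re (ip ([L, mult phi]%OP (u t)) (ut t)))%:C,
        cderivable (dot (Theta L phi u ut)) t &
        dot (dot (Theta L phi u ut)) t
          = - 2^-1 * ip ([L, [L, mult phi]]%OP (u t)) (u t)].
Proof.
have symL := selfadjoint_symmetric HL; have symphi := @mult_symmetric R n k phi.
have [_ _ eqn] := Hu; case: Hreg => domu domut domc dkin dpot dcomm.
have utt_Lu t : utt t = - L (u t).
  by have [_ /eqP] := eqn t; rewrite addr_eq0 => /eqP.
have Theta1 t : cderivable (Theta L phi u ut) t /\ dot (Theta L phi u ut) t =
    (complex.Re (ip ([L, mult phi]%OP (u t)) (ut t)))%:C.
  (* The two summands of $\Theta$ are differentiated separately; taking the real part commutes with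
     the time derivative. *)
  have [kd kE] := dkin t; have [pd pE] := dpot t; have [pd' pE'] := dotRe pd.
  have [cd ->] := dotD kd pd'; split => //; rewrite {}pE' {}kE {}pE.
  have [[Lu phiLu] _] := domu t.
  by rewrite !utt_Lu ip_Theta_dot//; exact: dom_multN.
move=> t; have [dTheta dThetaE] := Theta1 t.
(* The first identity, as an equality of functions of time, can be differentiated again. *)
have dotThetaE : dot (Theta L phi u ut) =
    fun s => (complex.Re (ip ([L, mult phi]%OP (u s)) (ut s)))%:C.
  by apply/funext => s; have [] := Theta1 s.
have [cd cE] := dcomm t; have [cd' cE'] := dotRe cd.
rewrite dotThetaE; split => //.
rewrite {}cE' {}cE.
(* These four memberships also put $u_t$ in the domain of $[L,\phi]$, as needed for
   $\Re([L,\phi]u_t,u_t)=0$. *)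
have [[Lut phiLut] [phiut Lphiut]] := domut t.
rewrite ip_double_commutator// utt_Lu ReD Re_ip_commutator// add0r ipNr ReN.
by rewrite mulrA mulNr mulVf ?pnatr_eq0// mulN1r rmorphN.
Qed.
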